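(* Fix either the unit-range normalization or the unit-sum normalization of valuation functions. Then: (i) There exist absolute constants $c, C > 0$ such that for every $n \ge 1$, the approximation ratio of random priority on $n$ agents and $n$ items satisfies $c/\sqrt{n} \le ar(RP) \le C/\sqrt{n}$, i.e. $ar(RP) = \Theta(n^{-1/2})$. (ii) There exists an absolute constant $C' > 0$ such that for every $n \ge 1$, every truthful-in-expectation mechanism $J$ (deterministic or randomized) for $n$ agents and $n$ items satisfies $ar(J) \le C'/\sqrt{n}$. (iii) There exists an absolute constant $C'' > 0$ such that for every $n \ge 1$, every ordinal mechanism $J$ (not necessarily truthful-in-expectation, deterministic or randomized) for $n$ agents and $n$ items satisfies $ar(J) \le C''/\sqrt{n}$.
   Context: Setting: a set of agents $N=\{1,\dots,n\}$ and a set of items $M=\{1,\dots,n\}$. An outcome is a matching, i.e. a bijection $\mu$ assigning to each agent $i$ a distinct item $\mu_i$; $O$ denotes the set of all outcomes. Each agent $i$ has a valuation function $u_i: M \to \mathbb{R}$ which is injective (no ties). Unit-range normalization: $\max_j u_i(j)=1$ and $\min_j u_i(j)=0$. Unit-sum normalization: $\sum_{j\in M} u_i(j) = 1$ (and values are nonnegative). $V$ denotes the set of admissible (normalized, injective) valuation functions and $V^n$ the set of valuation profiles $\mathbf u=(u_1,\dots,u_n)$. A (randomized) mechanism is a map $J$ assigning to every profile $\mathbf u\in V^n$ a probability distribution over $O$ (deterministic if the distribution is a point mass); $J(\mathbf u)_i$ is the (random) item assigned to agent $i$. $J$ is truthful-in-expectation if for every $i$, every $\mathbf u=(u_i,u_{-i})\in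 V^n$ and every $\tilde u_i\in V$, $\mathbb E[u_i(J(u_i,u_{-i})_i)] \ge \mathbb E[u_i(J(\tilde u_i,u_{-i})_i)]$. $J$ is ordinal if $J(u_i,u_{-i}) = J(u_i',u_{-i})$ (as distributions) whenever $u_i$ and $u_i'$ induce the same ordering of items. The approximation ratio is $ar(J)=\inf_{\mathbf u\in V^n} \mathbb E[\sum_i u_i(J(\mathbf u)_i)]/w^*(\mathbf u)$, where $w^*(\mathbf u)=\max_{\mu\in O}\sum_i u_i(\mu_i)$. Random priority (RP) picks a uniformly random ordering of the agents and then, in that order, assigns each agent its most preferred item among those not yet assigned.
   Formalization: Under the unit-range normalization the result is stated for n ≥ 2 instead of n ≥ 1, since for n = 1 no valuation has both maximum 1 and minimum 0, so V is empty and the approximation ratio is undefined. *)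

(* Defs.v *)
From mathcomp Require Import all_boot all_fingroup.
From Stdlib Require Import Reals ClassicalEpsilon.

Set Implicit Arguments.
Unset Strict Implicit.
Unset Printing Implicit Defensive.

Local Open Scope R_scope.

Inductive normalization := UnitRange | UnitSum.

(* A valuation of an agent: item -> value. Agents and items are 'I_n. *)
Definition valuation (n : nat) := 'I_n -> R.
(* A profile: agent -> item -> value. *)
Definition profile (n : nat) := 'I_n -> 'I_n -> R.

Definition Rsum (n : nat) (f : 'I_n -> R) : R := \big[Rplus/0]_(j : 'I_n) f j.

Definition admissible (N : normalization) (n : nat) (v : valuation n) : Prop :=
  injective v /\
  match N with
  | UnitRange =>
      (forall j, 0 <= v j <= 1) /\ (exists j, v j = 1) /\ (exists j, v j = 0)
  | UnitSum => (forall j, 0 <= v j) /\ Rsum v = 1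
  end.

Definition admissible_profile (N : normalization) (n : nat) (u : profile n) : Prop :=
  forall i, admissible N (u i).

(* Outcomes O = matchings = permutations s of 'I_n; agent i gets item s i. *)

(* A (randomized) mechanism: a profile is mapped to a probability
   function on outcomes.  Only its values on admissible profiles matter. *)
Definition mechanism (n : nat) := profile n -> {perm 'I_n} -> R.

Definition is_distribution (n : nat) (p : {perm 'I_n} -> R) : Prop :=
  (forall s, 0 <= p s) /\ \big[Rplus/0]_(s : {perm 'I_n}) p s = 1.

Definition is_mechanism (N : normalization) (n : nat) (J : mechanism n) : Prop :=
  forall u, admissible_profile N u -> is_distribution (J u).

Definition update (n : nat) (u : profile n) (i : 'I_n) (v : valuation n) : profile n :=
  fun k => if k == i then v else u k.

Definition exp_utility (n : nat) (J : mechanism n) (u : profile n) (v : valuation n)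
  (i : 'I_n) : R :=
  \big[Rplus/0]_(s : {perm 'I_n}) (J u s * v (s i)).

Definition truthful (N : normalization) (n : nat) (J : mechanism n) : Prop :=
  forall (i : 'I_n) (u : profile n) (vt : valuation n),
    admissible_profile N u -> admissible N vt ->
    exp_utility J (update u i vt) (u i) i <= exp_utility J u (u i) i.

Definition same_order (n : nat) (v w : valuation n) : Prop :=
  forall j k : 'I_n, v j < v k <-> w j < w k.

Definition ordinal_mech (N : normalization) (n : nat) (J : mechanism n) : Prop :=
  forall (i : 'I_n) (u : profile n) (w : valuation n),
    admissible_profile N u -> admissible N w -> same_order (u i) w ->
    forall s, J u s = J (update u i w) s.

Definition welfare (n : nat) (u : profile n) (s : {perm 'I_n}) : R :=
  Rsum (fun i => u i (s i)).

Definition exp_welfare (n : nat) (J : mechanism n) (u : profile n) : R :=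
  \big[Rplus/0]_(s : {perm 'I_n}) (J u s * welfare u s).

(* Maximum over all matchings (welfares are nonnegative for admissible
   profiles, so the neutral element 0 of Rmax is harmless). *)
Definition wstar (n : nat) (u : profile n) : R :=
  \big[Rmax/0]_(s : {perm 'I_n}) welfare u s.

Definition is_glb (S : R -> Prop) (r : R) : Prop :=
  (forall x, S x -> r <= x) /\ (forall b, (forall x, S x -> b <= x) -> b <= r).

Definition Rinf (S : R -> Prop) : R := epsilon (inhabits 0) (fun r => is_glb S r).

Definition ratio_set (N : normalization) (n : nat) (J : mechanism n) : R -> Prop :=
  fun r => exists u : profile n, admissible_profile N u /\ r = exp_welfare J u / wstar u.

Definition ar (N : normalization) (n : nat) (J : mechanism n) : R :=
  Rinf (ratio_set N J).

Definition best (n : nat) (v : valuation n) (A : seq 'I_n) (d : 'I_n) : 'I_n :=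
  foldr (fun j b => if Rlt_dec (v b) (v j) then j else b) (head d A) A.

Fixpoint sd_aux (n : nat) (u : profile n) (ord avail : seq 'I_n)
  (f : 'I_n -> 'I_n) : 'I_n -> 'I_n :=
  match ord with
  | [::] => f
  | i :: rest =>
      let j := best (u i) avail i in
      sd_aux u rest (rem j avail) (fun k => if k == i then j else f k)
  end.

Definition serial_dictatorship (n : nat) (u : profile n) (sigma : {perm 'I_n})
  : 'I_n -> 'I_n :=
  sd_aux u [seq sigma k | k <- enum 'I_n] (enum 'I_n) (fun k : 'I_n => k).

Definition RP (n : nat) : mechanism n :=
  fun u s =>
    INR #|[pred sigma : {perm 'I_n} | [forall i, serial_dictatorship u sigma i == s i]]|
    / INR #|{perm 'I_n}|.

(* Smallest number of agents for which V is nonempty. *)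
Definition min_agents (N : normalization) : nat :=
  match N with UnitRange => 2%nat | UnitSum => 1%nat end.

(* Main.v *)
(** Lower bound for random priority.  Let [E] be its expected welfare.  If [w] is
    the weight of a matching that survives among the remaining agents and items,
    the next pick gains at least [w / n] on average and lowers [w] by at most 2,
    so [E >= w*^2 / (4 n)] by induction.  Also [E >= 1]: for the unit range the
    first pick has value 1; for the unit sum, the mean over the remaining agents
    of the total value of the remaining items, which is 1 initially, drops on
    average by no more than what is gained.  Hence [E / w* >= 1 / (2 sqrt n)].

    Upper bound for truthful or ordinal mechanisms.  Take [K ~ sqrt n] groups of
    [K] agents.  Everybody wants one common item most (value 1), and then the
    item of their group, at value [1 / K] or, for a deviating agent, [1 / 2].  In
    each group independently, with probability 1/2, one uniformly random agent
    deviates; the optimum is then of order [K].  If an agent of group [g] starts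
    to deviate, truthfulness bounds the new probability of getting item [g] by
    the old one plus [K] times the old probability of getting the common item;
    ordinality bounds it by the old one.  As the deviating agent is random, the
    deviating agents obtain O(1) in total on average, and so do all the others.
    Dividing by the sum, which lies between 1 and 3, turns unit-range values into
    unit-sum ones. *)

Require Import Defs.
From Stdlib Require Import Reals ClassicalEpsilon FunctionalExtensionality.
From mathcomp Require Import all_boot all_fingroup all_order all_algebra.
From mathcomp Require Import Rstruct ring lra zify.

Set Implicit Arguments.
Unset Strict Implicit.
Unset Printing Implicit Defensive.

Import Order.TTheory GRing.Theory Num.Theory.

Local Open Scope ring_scope.

(** * Approximation ratio and normalization *)

(** [Rinf] is an [epsilon] choice, hence the infimum only once one exists; completeness, applied to
    the reflected set, supplies it. *)
Lemma Rinf_glb (S : R -> Prop) (b : R) :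
  (exists x, S x) -> (forall x, S x -> b <= x) -> is_glb S (Rinf S).
Proof.
move=> [x0 Sx0] Sb; apply: epsilon_spec.
pose T y := S (- y).
have [||m [mub mlub]] := completeness T.
- by exists (- b) => y /Sb h; apply/RleP; rewrite lerNr.
- by exists (- x0); rewrite /T opprK.
exists (- m); split=> [x Sx|c cS]; apply/RleP.
- by rewrite lerNl; apply/RleP/mub; rewrite /T opprK.
- rewrite lerNr; apply/RleP/mlub => y /cS /RleP h; apply/RleP.
  by rewrite lerNr.
Qed.

Section Welfare.
Variables (N : normalization) (n : nat).
Implicit Types (J : mechanism n) (u : profile n) (v : valuation n).

Lemma admissible_ge0 v : admissible N v -> forall j, 0 <= v j.
Proof. by case: N => -[_ []] => [h _ j|h _ j]; apply/RleP; case: (h j). Qed.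

Lemma admissible_le1 v : admissible N v -> forall j, v j <= 1.
Proof.
move=> av j; have v0 := admissible_ge0 av; move: av.
case: N => -[_ []] => [h _|h]; first by apply/RleP; case: (h j).
move=> v1; have <- : \sum_j v j = 1 := v1.
by rewrite (bigD1 j) //= lerDl sumr_ge0.
Qed.

Lemma admissible_gt0 v : admissible N v -> exists j, 0 < v j.
Proof.
move=> av; have v0 := admissible_ge0 av; move: av.
case: N => -[_ []] => [_ [[j vj] _]|_]; first by exists j; rewrite vj ltr01.
move=> v1; have v1' : \sum_j v j = 1 := v1.
have [j vj|h] := pickP (fun j => 0 < v j); first by exists j.
suff v00 j : v j = 0.
  by move/eqP: v1'; rewrite big1 // eq_sym oner_eq0.
by apply/le_anti; rewrite v0 andbT leNgt h.
Qed.

Lemma wstar_ge u s : welfare u s <= wstar u.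
Proof.
rewrite /wstar; have: s \in index_enum {perm 'I_n} by rewrite mem_index_enum.
elim: index_enum => // t r IH; rewrite in_cons big_cons RmaxE le_max.
by case/orP=> [/eqP->|/IH ->]; rewrite ?lexx ?orbT.
Qed.

Variable u : profile n.
Hypothesis adm_u : admissible_profile N u.

Lemma welfare_ge0 s : 0 <= welfare u s.
Proof.
have -> : welfare u s = \sum_i u i (s i) by [].
by apply: sumr_ge0 => i _; apply: admissible_ge0.
Qed.

Lemma wstar_attained : exists s, wstar u <= welfare u s.
Proof.
apply: (big_ind (fun x : R => exists s, x <= welfare u s)).
(* The default 0 of the maximum lies below every welfare. *)
- by exists 1%g; apply: welfare_ge0.
- move=> x y [s xs] [t yt]; rewrite RmaxE; case: (leP x y) => _.
    by exists t.
  by exists s.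
- by move=> s _; exists s.
Qed.

Lemma wstar_gt0 (i : 'I_n) : 0 < wstar u.
Proof.
have [j uj] := admissible_gt0 (adm_u i).
apply: lt_le_trans (wstar_ge u (tperm i j)); apply: (lt_le_trans uj).
have -> : welfare u (tperm i j) = \sum_k u k (tperm i j k) by [].
rewrite (bigD1 i) //= tpermL lerDl; apply: sumr_ge0 => k _.
exact: admissible_ge0.
Qed.

Lemma exp_welfare_ge0 J : is_mechanism N J -> 0 <= exp_welfare J u.
Proof.
move=> /(_ _ adm_u) [J0 _].
have -> : exp_welfare J u = \sum_s J u s * welfare u s by [].
apply: sumr_ge0 => s _; apply: mulr_ge0; last exact: welfare_ge0.
exact/RleP.
Qed.

Lemma exp_welfare_le_wstar J : is_mechanism N J -> exp_welfare J u <= wstar u.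
Proof.
move=> /(_ _ adm_u) [J0 J1].
have -> : exp_welfare J u = \sum_s J u s * welfare u s by [].
have J1' : \sum_s J u s = 1 := J1; rewrite -[wstar u]mul1r -J1'.
rewrite mulr_suml; apply: ler_sum => s _; apply: ler_wpM2l; first exact/RleP.
exact: wstar_ge.
Qed.

End Welfare.

Lemma ar_glb (N : normalization) (n : nat) (J : mechanism n.+1) :
  is_mechanism N J -> (exists v : valuation n.+1, admissible N v) ->
  is_glb (ratio_set N J) (ar N J).
Proof.
move=> mJ [v av]; apply: (@Rinf_glb _ 0).
  by eexists; exists (fun=> v); split.
move=> x [u [au ->]]; apply: divr_ge0; first exact: exp_welfare_ge0 mJ.
exact/ltW/(wstar_gt0 au ord0).
Qed.

(** Cleared of its denominator, the bound can be summed over a family of profiles. *)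
Lemma ar_wstar_le (N : normalization) (n : nat) (J : mechanism n.+1)
    (u : profile n.+1) :
  is_mechanism N J -> admissible_profile N u ->
  ar N J * wstar u <= exp_welfare J u.
Proof.
move=> mJ au; have [lb _] := ar_glb mJ (ex_intro _ _ (au ord0)).
rewrite -ler_pdivlMr ?(wstar_gt0 au ord0) //.
by apply/RleP/lb; exists u.
Qed.

Lemma ar_le1 (N : normalization) (n : nat) (J : mechanism n.+1) :
  is_mechanism N J -> (exists v : valuation n.+1, admissible N v) ->
  ar N J <= 1.
Proof.
move=> mJ [v av]; have au : admissible_profile N (fun=> v) by [].
have := le_trans (ar_wstar_le mJ au) (exp_welfare_le_wstar au mJ).
by rewrite -{2}[wstar _]mul1r ler_pM2r ?(wstar_gt0 au ord0).
Qed.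

(** For the unit range nothing is rescaled, so weights must have maximum 1 and minimum 0 from the
    start. *)
Definition scaling (N : normalization) (n : nat) (w : valuation n) : R :=
  (match N with UnitRange => 1 | UnitSum => (\sum_j w j)^-1 end)%R.

Definition normalize (N : normalization) (n : nat) (w : valuation n) :
  valuation n := fun j => scaling N w * w j.

Lemma scaling_gt0 N n (w : valuation n) j0 :
  (forall j, 0 <= w j) -> 0 < w j0 -> 0 < scaling N w.
Proof.
case: N => //= w0 wj; rewrite invr_gt0 (bigD1 j0) //=.
by apply: ltr_wpDr => //; apply: sumr_ge0.
Qed.

Lemma admissible_normalize N n (w : valuation n) :
  injective w -> (forall j, 0 <= w j <= 1) -> (exists j, w j = 1) ->
  (exists j, w j = 0) \/ N = UnitSum -> admissible N (normalize N w).
Proof.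
move=> injw w01 [j1 wj1] w0.
have wge0 j : 0 <= w j by case/andP: (w01 j).
have sc0 : 0 < scaling N w by apply: (@scaling_gt0 _ _ _ j1) => //; rewrite wj1.
split.
  by move=> j k /(mulfI (lt0r_neq0 sc0)) /injw.
case: N w0 sc0 => [[[j0 wj0]|//] _|_ sc0]; rewrite /normalize.
- split; [|split].
  + by move=> j; rewrite mul1r; case/andP: (w01 j) => ? ?; split; apply/RleP.
  + by exists j1; rewrite mul1r.
  + by exists j0; rewrite mul1r.
- split=> [j|]; first by apply/RleP/mulr_ge0; rewrite ?wge0 // ltW.
  have -> : Rsum (fun j => scaling UnitSum w * w j) = \sum_j scaling UnitSum w * w j by [].
  rewrite -mulr_sumr mulVf //; move: sc0; rewrite /= invr_gt0.
  exact: lt0r_neq0.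
Qed.

Lemma admissible_exists (N : normalization) (n : nat) :
  (min_agents N <= n.+1)%N -> exists v : valuation n.+1, admissible N v.
Proof.
(* Equally spaced values from 1 down to 0. For a single item the quotient is [0 / 0 = 0], which
   leaves the value 1. *)
move=> minN; pose w (j : 'I_n.+1) : R := 1 - j%:R / n%:R.
exists (normalize N w); apply: admissible_normalize.
- move=> j k; rewrite /w; case: n j k {w minN} => [|m] j k.
    by rewrite !ord1.
  have m0 : (m.+1%:R : R)^-1 != 0 by rewrite invr_eq0 pnatr_eq0.
  move=> /(addrI 1)/oppr_inj/(mulIf m0)/eqP; rewrite eqr_nat => /eqP.
  exact: val_inj.
- move=> j; rewrite /w subr_ge0 lerBlDr lerDl divr_ge0 ?ler0n // andbT.
  case: n j {w minN} => [|m] j; first by rewrite ord1 mul0r ler01.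
  by rewrite ler_pdivrMr ?ltr0n // mul1r ler_nat -ltnS.
- by exists ord0; rewrite /w mul0r subr0.
- case: N minN => /= minN; last by right.
  left; exists ord_max; rewrite /w divff ?subrr // pnatr_eq0.
  by case: n {w} minN.
Qed.

(** * Serial dictatorship *)

Section SerialDictatorship.
Variable n : nat.
Implicit Types (v : valuation n) (u : profile n) (A l : seq 'I_n).

Let pick v := fun j b : 'I_n => if Rlt_dec (v b) (v j) then j else b.

Lemma bestP v A d : (0 < size A)%N ->
  best v A d \in A /\ forall j, j \in A -> v j <= v (best v A d).
Proof.
(* The fold is studied from any start [b], counted as a candidate; [best] starts from the head,
   which is in the list anyway. *)
have gen b B : foldr (pick v) b B \in b :: B /\
    forall j, j \in b :: B -> v j <= v (foldr (pick v) b B).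
  elim: B => [|c B [IHin IHmax]] /=.
    by split=> [|j]; rewrite mem_seq1 // => /eqP->.
  rewrite {1 3}/pick; case: Rlt_dec => /= [/RltP/ltW lt|nlt]; last first.
    have le : v c <= v (foldr (pick v) b B) by rewrite leNgt; apply/negP => /RltP.
    split=> [|j].
      by move: IHin; rewrite !inE => /orP[->//|->]; rewrite !orbT.
    rewrite !inE => /or3P[/eqP->|/eqP->//|jB]; apply: IHmax; rewrite inE ?eqxx //.
    by rewrite jB orbT.
  split=> [|j]; first by rewrite !inE eqxx orbT.
  rewrite !inE => /or3P[/eqP->|/eqP->//|jB]; apply: (le_trans (IHmax _ _) lt).
    by rewrite inE eqxx.
  by rewrite inE jB orbT.
rewrite /best; case: A => // a A _; have [h1 h2] := gen a (a :: A).
split=> [|j jA]; first by move: h1; rewrite -/(pick v) /= !inE orbA orbb.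
by apply: h2; rewrite inE jA orbT.
Qed.

Lemma best_same_order v w A d : same_order v w -> best v A d = best w A d.
Proof.
move=> vw; rewrite /best; move: (head d A) => b; elim: A => //= a A ->.
set c := foldr _ _ _; have := vw c a.
by do 2 case: Rlt_dec => ? //=; tauto.
Qed.

Lemma sd_aux_same_order u u' : (forall i, same_order (u i) (u' i)) ->
  forall l A f, sd_aux u l A f = sd_aux u' l A f.
Proof.
move=> uu' l; elim: l => //= i l IH A f.
by rewrite (best_same_order _ _ (uu' i)) IH.
Qed.

Lemma sd_aux_notin u l A f k : k \notin l -> sd_aux u l A f k = f k.
Proof.
elim: l A f => //= i l IH A f; rewrite inE negb_or => /andP[/negPf ki kl].
by rewrite IH // ki.
Qed.

(** Value collected by serial dictatorship, freed from the accumulator of [sd_aux] so that it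
    unfolds pick by pick. *)
Fixpoint sd_value u l A : R :=
  (if l is i :: l' then
    u i (best (u i) A i) + sd_value u l' (rem (best (u i) A i) A)
  else 0)%R.

Lemma sd_auxP u l A f : uniq l -> uniq A -> (size l <= size A)%N ->
  [/\ {in l, forall k, sd_aux u l A f k \in A},
      {in l &, injective (sd_aux u l A f)} &
      \sum_(i <- l) u i (sd_aux u l A f i) = sd_value u l A].
Proof.
elim: l A f => [|i l IH] A f /=; first by rewrite big_nil; split.
case/andP=> il ul uA szA.
have [bA _] := bestP (u i) i (leq_ltn_trans (leq0n _) szA).
set b := best _ _ _ in bA *; set f' := fun k : 'I_n => if k == i then b else f k.
have uA' : uniq (rem b A) by rewrite rem_uniq.
have szA' : (size l <= size (rem b A))%N by rewrite size_rem // -ltnS (ltn_predK szA).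
have [IHin IHinj IHsum] := IH (rem b A) f' ul uA' szA'.
have fi : sd_aux u l (rem b A) f' i = b by rewrite sd_aux_notin // /f' eqxx.
have fl k : k \in l -> sd_aux u l (rem b A) f' k != b.
  by move=> /IHin; apply: contraTneq => ->; rewrite mem_rem_uniqF.
split.
- move=> k; rewrite inE => /orP[/eqP->|/IHin/mem_rem//]; by rewrite fi.
- move=> k k'; rewrite !inE => /orP[/eqP->|kl] /orP[/eqP->|kl'] //; rewrite ?fi.
  + by move=> e; move: (fl _ kl'); rewrite -e eqxx.
  + by move=> e; move: (fl _ kl); rewrite e eqxx.
  + exact: IHinj.
- by rewrite big_cons fi IHsum.
Qed.

(** The expectation over a random order times the number of orders, which avoids divisions in the
    recursion. *)
Definition sd_sum u l A : R := \sum_(l' <- permutations l) sd_value u l' A.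

(** Conditioning on the first agent [a], with whom [m!] orders begin. *)
Lemma sd_sum_rec u l A m : uniq l -> size l = m.+1 ->
  sd_sum u l A = \sum_(a <- l) (m`!%:R * u a (best (u a) A a) +
    sd_sum u (rem a l) (rem (best (u a) A a) A)).
Proof.
move=> ul szl; rewrite /sd_sum (perm_big _ (permutationsE _)) ?szl //=.
rewrite big_allpairs_dep undup_id //=; apply: eq_big_seq => a al.
rewrite big_split /=; congr (_ + _).
rewrite big_const_seq count_predT size_permutations ?rem_uniq //.
by rewrite size_rem // szl /= iter_addr addr0 mulr_natl.
Qed.

Lemma sd_sum_nil u A : sd_sum u [::] A = 0.
Proof. by rewrite /sd_sum (perm_big [:: [::]]) ?big_seq1. Qed.

(** * Two lower bounds for the total over all orders *)

Section Bounds.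
Variable u : profile n.
Hypothesis u_ge0 : forall i j, 0 <= u i j.

Lemma sd_sum_ge0 l A : 0 <= sd_sum u l A.
Proof.
apply: sumr_ge0 => l' _; elim: l' A => //= a l' IH A.
by apply: addr_ge0; rewrite ?u_ge0 ?IH.
Qed.

(* With M_i the value of i's favourite available item, removing the item picked
   by a lowers i's total available value by at most M_i; averaged over a, the
   mean available value per remaining agent drops by at most the mean of the
   M_i, which is the expected value collected in that round. *)
Lemma sd_sum_ge_mean l A m : uniq l -> uniq A -> size l = m.+1 ->
  size A = m.+1 ->
  m`!%:R * (\sum_(i <- l) \sum_(j <- A) u i j) <= sd_sum u l A.
Proof.
elim: m l A => [|m IH] l A ul uA szl szA.
  case: l A szl szA {ul uA} => [//|a [|//]] [//|j [|//]] _ _.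
  rewrite (@sd_sum_rec _ _ _ 0) // !big_seq1 !mul1r.
  have [+ _] := @bestP (u a) [:: j] a isT; rewrite mem_seq1 => /eqP->.
  by rewrite lerDl sd_sum_ge0.
rewrite (sd_sum_rec _ _ ul szl).
pose M i := u i (best (u i) A i); pose U i : R := \sum_(j <- A) u i j.
have A0 : (0 < size A)%N by rewrite szA.
have bP i := bestP (u i) i A0.
(* What would be left if all agents lost their favourites. Summed over the [m.+2] first agents,
   [D - (U a - M a)] gives [m.+1] times [D], and [D] plus all [M i] is the sum of the [U i]. *)
pose D := \sum_(i <- l) (U i - M i).
suff step a : a \in l -> m.+1`!%:R * M a + m`!%:R * (D - (U a - M a)) <=
    m.+1`!%:R * M a + sd_sum u (rem a l) (rem (best (u a) A a) A).
  rewrite [leRHS]big_seq -/M; apply: le_trans (ler_sum _ step).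
  rewrite -big_seq big_split /= -!mulr_sumr sumrB.
  rewrite big_const_seq count_predT iter_addr addr0 szl -/D mulrSr addrK.
  rewrite /D sumrB factS natrM -mulr_natl /U /M; lra.
move=> al; rewrite lerD2l.
apply: le_trans (IH _ _ _ _ _ _); rewrite ?rem_uniq ?size_rem ?szl ?szA //;
  last by case: (bP a).
apply: ler_wpM2l; first exact: ler0n.
rewrite /D (big_rem a) //= addrAC subrr add0r.
apply: ler_sum => i _; rewrite /U (big_rem (best (u a) A a)) /=; last by case: (bP a).
by rewrite addrAC gerDr subr_le0; case: (bP i) => _; apply; case: (bP a).
Qed.

Hypothesis u_le1 : forall i j, u i j <= 1.

(* A pick by agent a destroys at most two pairs of the matching s: that of a
   and that of the item which a takes. *)
Lemma sd_sum_ge_square (s : {perm 'I_n}) l A : uniq l -> uniq A ->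
  (size l <= size A)%N ->
  (size l)`!%:R * ((\sum_(i <- l | s i \in A) u i (s i)) ^+ 2 / (4 * n%:R))
    <= sd_sum u l A.
Proof.
move szl : (size l) => m; elim: m l A szl => [|m IH] l A szl ul uA szA.
  by rewrite (size0nil szl) big_nil sd_sum_nil expr0n mul0r mulr0.
rewrite (sd_sum_rec _ _ ul szl).
pose M i := u i (best (u i) A i).
have bP i := bestP (u i) i (leq_ltn_trans (leq0n _) szA).
set W := \sum_(i <- l | _) _.
have W0 : 0 <= W by apply: sumr_ge0.
have n0 : (0 < n%:R :> R).
  by rewrite ltr0n; case: (n) l szl {ul szA W W0 M bP} => // -[|[]].
have mn : m.+1%:R <= n%:R :> R.
  by rewrite ler_nat -szl -[X in (_ <= X)%N](card_ord n) -(card_uniqP ul) max_card.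
(* The surviving matching weighs at least [W - 2]; truncation at 0 keeps squaring monotone. *)
pose h := Num.max 0 (W - 2) ^+ 2 / (4 * n%:R).
have WM : W <= \sum_(i <- l) M i.
  rewrite /W big_mkcond; apply: ler_sum => i _; case: ifP => [siA|_] //.
    by case: (bP i) => _; apply.
  exact: u_ge0.
have step a : a \in l -> m`!%:R * M a + m`!%:R * h <=
    m`!%:R * M a + sd_sum u (rem a l) (rem (best (u a) A a) A).
  move=> al; rewrite lerD2l; have [bA _] := bP a.
  apply: le_trans (IH _ _ _ _ _ _); rewrite ?rem_uniq ?size_rem ?szl //;
    last by case: (A) szA.
  apply: ler_wpM2l; first exact: ler0n.
  rewrite /h ler_pM2r ?invr_gt0 ?mulr_gt0 //.
  set W' := \sum_(i <- _ | _) _.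
  have W'0 : 0 <= W' by apply: sumr_ge0.
  rewrite lerXn2r ?nnegrE ?le_max ?lexx // ge_max W'0 /=.
  set b := best _ _ _ in W' W'0 bA *.
  (* As [s] is injective, at most one remaining agent loses its matched item. *)
  have c1 : \sum_(i <- rem a l) (s i == b)%:R <= 1 :> R.
    rewrite -natr_sum; rewrite (_ : (\sum_(i <- _) _)%N = count_mem b (map s (rem a l))).
      rewrite -[1]/(1%:R) ler_nat count_uniq_mem ?leq_b1 //.
      by rewrite map_inj_uniq ?rem_uniq //; apply: perm_inj.
    by rewrite count_map -sum1_count [RHS]big_mkcond; apply: eq_bigr => i _ /=; case: eqP.
  suff: W <= 1 + (W' + 1) by lra.
  rewrite /W big_mkcond (big_rem a) //=; apply: lerD; first by case: ifP.
  apply: le_trans (lerD (lexx _) c1); rewrite [W']big_mkcond -big_split /=.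
  apply: ler_sum => i _; rewrite mem_rem_uniq // inE.
  case: eqP => [->|_] /=; last by rewrite addr0.
  by rewrite add0r; case: ifP.
have hE : h = Num.max 0 (W - 2) ^+ 2 / (4 * n%:R) by [].
clearbody h.
rewrite [leRHS]big_seq -/M; apply: le_trans (ler_sum _ step).
rewrite -big_seq big_split /= -mulr_sumr.
rewrite big_const_seq count_predT iter_addr addr0 szl factS natrM.
rewrite -[X in _ + X]mulr_natr -[m`!%:R * h * _]mulrA -mulrDr.
rewrite [X in X * _]mulrC -mulrA ler_pM2l ?ltr0n ?fact_gt0 //.
apply: (@le_trans _ _ (W + h * m.+1%:R)); last by rewrite lerD2r.
apply: (@le_trans _ _ (m.+1%:R * (W / n%:R + h))); last first.
  rewrite mulrDr [_ * h]mulrC lerD2r mulrA ler_pdivrMr // mulrC.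
  exact: ler_wpM2l.
apply: ler_wpM2l; first exact: ler0n.
(* Times [4 * n], this reads [W ^+ 2 <= 4 * W + (W - 2) ^+ 2], or [W ^+ 2 <= 4 * W] when [W < 2];
   hence the constant 4. *)
have -> : W / n%:R = 4 * W / (4 * n%:R) by field; rewrite lt0r_neq0.
rewrite hE -mulrDl ler_pM2r ?invr_gt0 ?mulr_gt0 //.
by case: (leP 0 (W - 2)) => ?; nra.
Qed.

End Bounds.
End SerialDictatorship.

(** * Random priority *)

Section RandomPriority.
Variable n : nat.
Implicit Types (u : profile n) (s t : {perm 'I_n}).

Lemma perm_order_uniq t : uniq [seq t k | k <- enum 'I_n].
Proof. by rewrite map_inj_uniq ?enum_uniq //; apply: perm_inj. Qed.

Lemma mem_perm_order t i : i \in [seq t k | k <- enum 'I_n].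
Proof.
by apply/mapP; exists (t^-1%g i); rewrite ?mem_enum // permKV.
Qed.

Lemma perm_order_perm_eq t : perm_eq [seq t k | k <- enum 'I_n] (enum 'I_n).
Proof.
apply: uniq_perm; rewrite ?perm_order_uniq ?enum_uniq // => i.
by rewrite mem_perm_order mem_enum.
Qed.

Lemma serial_dictatorshipP u t :
  injective (serial_dictatorship u t) /\
  \sum_i u i (serial_dictatorship u t i) =
    sd_value u [seq t k | k <- enum 'I_n] (enum 'I_n).
Proof.
have sz : (size [seq t k | k <- enum 'I_n] <= size (enum 'I_n))%N.
  by rewrite size_map.
have [_ inj sumE] := sd_auxP u id (perm_order_uniq t) (enum_uniq 'I_n) sz.
split; first by move=> i j; apply: inj; apply: mem_perm_order.
rewrite -sumE (perm_big _ (perm_order_perm_eq t)) /= big_enum /=.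
by apply: eq_bigr.
Qed.

Definition sd_perm u t : {perm 'I_n} := perm (proj1 (serial_dictatorshipP u t)).

Lemma RP_E u s :
  RP u s = (n`!%:R)^-1 * \sum_t (sd_perm u t == s)%:R.
Proof.
rewrite /RP RdivE !INRE mulrC; congr (_^-1 * _).
  by rewrite -(card_Sn n); congr (_%:R); apply: eq_card => t; rewrite !inE.
rewrite -natr_sum -sum1_card big_mkcond /=; congr (_%:R); apply: eq_bigr => t _.
rewrite inE; congr nat_of_bool; apply/forallP/eqP => [h|<- i].
  by apply/permP => i; rewrite permE; apply/eqP.
by rewrite permE.
Qed.

Lemma RP_mechanism N : is_mechanism N (@RP n).
Proof.
move=> u _; split=> [s|].
  apply/RleP; rewrite RP_E mulr_ge0 ?invr_ge0 ?ler0n //.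
  by apply: sumr_ge0 => t _; apply: ler0n.
suff : \sum_s RP u s = 1 by [].
under eq_bigr do rewrite RP_E; rewrite -mulr_sumr exchange_big /=.
rewrite (eq_bigr (fun=> 1)) => [|t _].
  by rewrite sumr_const card_Sn mulVf // pnatr_eq0 -lt0n fact_gt0.
rewrite (bigD1 (sd_perm u t)) //= eqxx big1 ?addr0 // => s /negPf.
by rewrite eq_sym => ->.
Qed.

Lemma RP_ordinal N : ordinal_mech N (@RP n).
Proof.
move=> i u w _ _ uw s; rewrite /RP; congr (Rdiv (INR _) _).
apply: eq_card => t; rewrite !inE; apply: eq_forallb => k.
rewrite /serial_dictatorship (@sd_aux_same_order _ u (update u i w)) // => k'.
by rewrite /update; case: eqP => [->|].
Qed.

Lemma exp_welfare_RP u :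
  exp_welfare (@RP n) u = (n`!%:R)^-1 * sd_sum u (enum 'I_n) (enum 'I_n).
Proof.
have -> : exp_welfare (@RP n) u = \sum_s RP u s * welfare u s by [].
under eq_bigr do rewrite RP_E -mulrA; rewrite -mulr_sumr; congr (_ * _).
under eq_bigr do rewrite mulr_suml; rewrite exchange_big /=.
transitivity (\sum_(t : {perm 'I_n}) sd_value u [seq t k | k <- enum 'I_n] (enum 'I_n)).
  apply: eq_bigr => t _; rewrite (bigD1 (sd_perm u t)) //= eqxx mul1r big1.
    rewrite addr0 -(proj2 (serial_dictatorshipP u t)).
    have -> : welfare u (sd_perm u t) = \sum_i u i (sd_perm u t i) by [].
    by apply: eq_bigr => i _; rewrite permE.
  by move=> s /negPf; rewrite eq_sym => ->; rewrite mul0r.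
(* From permutations to lists: the map is injective, lands in [permutations], and both sides have
   [n!] elements. *)
rewrite -(big_map (fun t : {perm 'I_n} => [seq t k | k <- enum 'I_n]) predT
  (fun l => sd_value u l (enum 'I_n))) /=.
apply: perm_big; set L := map _ _.
have uL : uniq L.
  rewrite map_inj_uniq ?index_enum_uniq // => s t st.
  by apply/permP => k; move/eq_in_map: st; apply; rewrite mem_enum.
have subL : {subset L <= permutations (enum 'I_n)}.
  by move=> l /mapP[t _ ->]; rewrite mem_permutations perm_order_perm_eq.
have szL : (size (permutations (enum 'I_n)) <= size L)%N.
  rewrite size_permutations ?enum_uniq // -[size (enum _)]cardE card_ord size_map.
  rewrite -card_Sn cardE; apply/eq_leq/perm_size/uniq_perm => [||t].
  - exact: enum_uniq.
  - exact: index_enum_uniq.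
  - by rewrite mem_enum mem_index_enum inE.
have [_ eqL] := uniq_min_size uL subL szL.
by apply: uniq_perm; rewrite ?permutations_uniq.
Qed.

End RandomPriority.

(** * Lower bound for the ratio of random priority *)

Section LowerBound.
Variables (N : normalization) (n : nat) (u : profile n.+1).
Hypothesis adm_u : admissible_profile N u.

Let u_ge0 i j : 0 <= u i j := admissible_ge0 (adm_u i) j.

Lemma exp_welfare_RP_ge1 : 1 <= exp_welfare (@RP n.+1) u.
Proof.
rewrite exp_welfare_RP mulrC ler_pdivlMr ?ltr0n ?fact_gt0 // mul1r.
have sz : size (enum 'I_n.+1) = n.+1 by rewrite -cardE card_ord.
case: N adm_u => adm; last first.
  apply: le_trans (sd_sum_ge_mean u_ge0 (enum_uniq _) (enum_uniq _) sz sz).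
  rewrite factS natrM mulrC ler_pM2l ?ltr0n ?fact_gt0 //.
  rewrite big_enum (eq_bigr (fun=> 1)) /= => [|i _].
    by rewrite sumr_const card_ord.
  by rewrite big_enum; case: (adm i) => _ [].
rewrite (sd_sum_rec _ _ (enum_uniq _) sz).
apply: (@le_trans _ _ (\sum_(a <- enum 'I_n.+1) n`!%:R)).
  by rewrite big_enum sumr_const card_ord factS natrM mulr_natl.
apply: ler_sum => a _; have A0 : (0 < size (enum 'I_n.+1))%N by rewrite sz.
have [_ max] := bestP (u a) a A0.
case: (adm a) => _ [_ [[j uj] _]].
rewrite -[leLHS]addr0; apply: lerD; last exact: sd_sum_ge0.
rewrite -[leLHS]mulr1; apply: ler_wpM2l; first exact: ler0n.
by have := max j; rewrite mem_enum uj => /(_ isT).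
Qed.

Lemma exp_welfare_RP_ge_square :
  wstar u ^+ 2 / (4 * n.+1%:R) <= exp_welfare (@RP n.+1) u.
Proof.
have [s ws] := wstar_attained adm_u.
rewrite exp_welfare_RP [leRHS]mulrC ler_pdivlMr ?ltr0n ?fact_gt0 // [leLHS]mulrC.
have sz : size (enum 'I_n.+1) = n.+1 by rewrite -cardE card_ord.
have u_le1 i j := admissible_le1 (adm_u i) j.
have := sd_sum_ge_square u_ge0 u_le1 s (enum_uniq 'I_n.+1) (enum_uniq 'I_n.+1)
  (leqnn _).
rewrite sz; apply: le_trans; apply: ler_wpM2l; first exact: ler0n.
rewrite ler_pM2r ?invr_gt0 ?mulr_gt0 ?ltr0n // lerXn2r ?nnegrE //.
- exact/ltW/(wstar_gt0 adm_u ord0).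
- by apply: sumr_ge0.
- rewrite (eq_bigl xpredT) => [|i]; last by rewrite mem_enum.
  by rewrite big_enum.
Qed.

Lemma RP_ratio_ge :
  2^-1 / Num.sqrt n.+1%:R <= exp_welfare (@RP n.+1) u / wstar u.
Proof.
have w0 := wstar_gt0 adm_u ord0; have E1 := exp_welfare_RP_ge1.
have := exp_welfare_RP_ge_square.
set E := exp_welfare _ _ in E1 *; set w := wstar u in w0 *.
have s0 : 0 < Num.sqrt n.+1%:R :> R by rewrite sqrtr_gt0 ltr0n.
have sq : Num.sqrt n.+1%:R ^+ 2 = n.+1%:R :> R by rewrite sqr_sqrtr ?ler0n.
rewrite -{1}sq; move: s0; set q := Num.sqrt _ => q0.
rewrite ler_pdivrMr ?mulr_gt0 ?exprn_gt0 // => Ew.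
rewrite ler_pdivlMr // mulrAC ler_pdivrMr //.
have Eq0 : 0 <= E * q by rewrite mulr_ge0 ?(ltW q0) ?(le_trans ler01).
(* Since [E >= 1], the bound [4 * q ^+ 2 * E] on [w ^+ 2] is at most [4 * q ^+ 2 * E ^+ 2]. *)
have wE : w ^+ 2 <= (2 * (E * q)) ^+ 2 by nra.
suff : w <= 2 * (E * q) by lra.
by rewrite -ler_sqr ?nnegrE ?(ltW w0) //; lra.
Qed.

End LowerBound.

Lemma ar_RP_ge (N : normalization) (n : nat) : (min_agents N <= n.+1)%N ->
  2^-1 / Num.sqrt n.+1%:R <= ar N (@RP n.+1).
Proof.
move=> minN; have [_] := ar_glb (@RP_mechanism n.+1 N) (admissible_exists minN).
move=> h; apply/RleP/h => x [u [au ->]]; apply/RleP; exact: RP_ratio_ge au.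
Qed.

(** * Upper bound *)

Lemma sum_inj_le (I T : finType) (h : I -> T) (f : T -> R) :
  injective h -> (forall i, 0 <= f i) -> \sum_a f (h a) <= \sum_i f i.
Proof.
move=> injh f0.
have -> : \sum_a f (h a) = \sum_(i in h @: setT) f i.
  by rewrite big_imset; [apply: eq_bigl => a; rewrite inE | move=> a b _ _ /injh].
by rewrite [leLHS]big_mkcond; apply: ler_sum => i _; case: ifP.
Qed.

(** Composing with a transposition corrects one value and, by injectivity, keeps those already
    right. *)
Lemma perm_extending (I : finType) (m : nat) (f h : I -> 'I_m) :
  injective f -> injective h -> exists s : {perm 'I_m}, forall a, s (f a) = h a.
Proof.
move=> injf injh.
suff [s sP] : exists s : {perm 'I_m}, {in enum I, forall a, s (f a) = h a}.
  by exists s => a; apply: sP; rewrite mem_enum.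
elim: (enum I) (enum_uniq I) => [|a l IH] /= => [_|/andP[al /IH[s sP]]].
  by exists 1%g.
exists (s * tperm (s (f a)) (h a))%g => b; rewrite inE permM => /orP[/eqP->|bl].
  by rewrite tpermL.
have ba : b != a by apply: contraTneq bl => ->.
have n1 : s (f a) != s (f b) by rewrite (inj_eq (@perm_inj _ s)) (inj_eq injf) eq_sym.
have n2 : h a != s (f b) by rewrite sP // (inj_eq injh) eq_sym.
by rewrite tpermD // sP.
Qed.

Definition alloc_prob (n : nat) (J : mechanism n) (u : profile n) (i j : 'I_n) : R :=
  \sum_s J u s * (s i == j)%:R.

Section AllocProb.
Variables (n : nat) (J : mechanism n) (u : profile n).
Hypothesis distJ : is_distribution (J u).

Lemma dist_ge0 s : 0 <= J u s.
Proof. by case: distJ => h _; apply/RleP. Qed.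

Lemma dist_sum1 : \sum_s J u s = 1.
Proof. by case: distJ. Qed.

Lemma alloc_prob_ge0 i j : 0 <= alloc_prob J u i j.
Proof.
by apply: sumr_ge0 => s _; rewrite mulr_ge0 ?dist_ge0 ?ler0n.
Qed.

Lemma alloc_prob_sum j : \sum_i alloc_prob J u i j = 1.
Proof.
rewrite exchange_big /= -[RHS]dist_sum1; apply: eq_bigr => s _.
rewrite -mulr_sumr (bigD1 ((s^-1)%g j)) //= permKV eqxx big1 ?addr0 ?mulr1 // => i.
by move=> ij; case: (s i =P j) => // e; move: ij; rewrite -e permK eqxx.
Qed.

End AllocProb.

(* All agents rank item n first; an agent of group g moreover values item g + 1
   at x, and everything else at almost nothing. *)
Section HardInstance.
Variables (N : normalization) (n K : nat).
Hypotheses (K_gt1 : (1 < K)%N) (KK_le : (K * K <= n.+1)%N).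

Let K_gt0 : (0 < K)%N := ltnW K_gt1.
Let K_lt : (K < n)%N.
Proof. by move: K_gt1 KK_le; clear; nia. Qed.

Let iv : R := (n.+1%:R)^-1.

Let iv_gt0 : 0 < iv.
Proof. by rewrite invr_gt0 ltr0n. Qed.

(** Shifted by one: item 0 stays a filler of value 0, the minimum that the unit range demands. *)
Definition group_item (g : 'I_K) : 'I_n.+1 := inord g.+1.

(** Distinct values for injectivity, each below [iv], so that all agents together get less than 1
    from fillers. *)
Definition filler (j : 'I_n.+1) : R := (j%:R * iv ^+ 2)%R.

Definition weight (g : 'I_K) (x : R) (j : 'I_n.+1) : R :=
  (if j == ord_max then 1 else if j == group_item g then x else filler j)%R.

(** Strictly between the fillers and the top value, so that the ordering does not depend on [x]. *)
Definition good_level (x : R) := iv < x < 1.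

Lemma group_itemE g : group_item g = g.+1 :> nat.
Proof. by rewrite inordK // ltnS (leq_trans (ltn_ord g)) // ltnW. Qed.

Lemma group_item_inj : injective group_item.
Proof.
move=> g h /(congr1 val) /=; rewrite -!/(nat_of_ord _) !group_itemE => -[].
exact: val_inj.
Qed.

Lemma group_item_neq_max g : group_item g != ord_max.
Proof.
rewrite -val_eqE /= -/(nat_of_ord _) group_itemE neq_ltn.
by rewrite (leq_ltn_trans (ltn_ord g)).
Qed.

Lemma filler_bounds j : 0 <= filler j < iv.
Proof.
rewrite /filler mulr_ge0 ?ler0n ?sqr_ge0 //= expr2 mulrA gtr_pMl //.
by rewrite ltr_pdivrMr ?ltr0n // mul1r ltr_nat ltn_ord.
Qed.

Lemma weight_bounds g x j : good_level x -> 0 <= weight g x j <= 1.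
Proof.
rewrite /weight => /andP[x0 x1]; have /andP[f0 f1] := filler_bounds j.
by case: ifP => _; [|case: ifP => _]; lra.
Qed.

Lemma weight_inj g x : good_level x -> injective (weight g x).
Proof.
move=> /andP[x0 x1] j k; rewrite /weight.
have /andP[f0 f1] := filler_bounds j; have /andP[h0 h1] := filler_bounds k.
case: (eqVneq j ord_max) => [ej|_]; case: (eqVneq k ord_max) => [ek|_];
  rewrite ?ej ?ek //; case: (eqVneq j (group_item g)) => [ej'|_];
  case: (eqVneq k (group_item g)) => [ek'|_] //;
  try (by move=> e; exfalso; lra); first by rewrite ej' ek'.
move=> /(mulIf _)/eqP; rewrite eqr_nat sqrf_eq0 (lt0r_neq0 iv_gt0) => /(_ isT)/eqP.
exact: val_inj.
Qed.

Lemma weight_same_order g x y : good_level x -> good_level y ->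
  forall j k, weight g x j < weight g x k -> weight g y j < weight g y k.
Proof.
move=> /andP[x0 x1] /andP[y0 y1] j k; rewrite /weight.
have /andP[f0 f1] := filler_bounds j; have /andP[h0 h1] := filler_bounds k.
case: (j == ord_max); case: (k == ord_max); case: (j == group_item g);
  by case: (k == group_item g) => h; lra.
Qed.

Lemma weight_ge g x j : 0 <= x ->
  x * (j == group_item g)%:R <= weight g x j.
Proof.
move=> x0; rewrite /weight; have /andP[f0 _] := filler_bounds j.
case: (eqVneq j (group_item g)) => [->|_]; rewrite ?mulr1 ?mulr0.
  by rewrite (negPf (group_item_neq_max g)).
by case: ifP.
Qed.

Lemma weight_le g x j : 0 <= x ->
  weight g x j <= (j == ord_max)%:R + x * (j == group_item g)%:R + iv.
Proof.
move=> x0; rewrite /weight; have /andP[_ f1] := filler_bounds j.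
by have := iv_gt0; do 2 case: eqP => _ /=; lra.
Qed.

Definition type_of (g : 'I_K) (x : R) : valuation n.+1 :=
  normalize N (weight g x).

Lemma type_admissible g x : good_level x -> admissible N (type_of g x).
Proof.
move=> gx; apply: admissible_normalize.
- exact: weight_inj.
- by move=> j; apply: weight_bounds.
- by exists ord_max; rewrite /weight eqxx.
- left; exists ord0; rewrite /weight -!val_eqE /= -/(nat_of_ord _) group_itemE /=.
  by rewrite /filler mul0r; case: (n) K_lt.
Qed.

Lemma weight_sum g x : good_level x -> 1 <= \sum_j weight g x j <= 3.
Proof.
move=> gx; have w01 j := weight_bounds g j gx.
case/andP: (gx) => x0 x1; have x_ge0 : 0 <= x by have := iv_gt0; lra.
apply/andP; split.
  rewrite (bigD1 ord_max) //= {1}/weight eqxx lerDl.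
  by apply: sumr_ge0 => j _; case/andP: (w01 j).
apply: le_trans (ler_sum _ (fun j _ => weight_le g j x_ge0)) _.
rewrite !big_split /= -mulr_sumr sumr_const card_ord -[iv *+ _]mulr_natl divff ?pnatr_eq0 //.
have e k : \sum_(j < n.+1) (j == k)%:R = 1 :> R.
  by rewrite (bigD1 k) //= eqxx big1 ?addr0 // => j /negPf->.
by rewrite !e; lra.
Qed.

Lemma scaling_weight g x : good_level x -> 3^-1 <= scaling N (weight g x) <= 1.
Proof.
move=> gx; have /andP[s1 s3] := weight_sum g gx.
case: N => /=; first by lra.
have s0 : 0 < \sum_j weight g x j by lra.
by rewrite lef_pV2 ?posrE // s3 invf_le1.
Qed.

(** * The random family of profiles *)

Lemma ltn_mod_K i : (i %% K < K)%N.
Proof. exact: ltn_pmod. Qed.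

Definition group (i : 'I_n.+1) : 'I_K := Ordinal (ltn_mod_K i).

(** Only the first [K * K] agents are members; later ones have a group by their residue but are
    never marked. *)
Definition member (g d : 'I_K) : 'I_n.+1 := inord (d * K + g).

Lemma memberE g d : member g d = (d * K + g)%N :> nat.
Proof.
rewrite inordK //; apply: leq_trans KK_le.
by have := ltn_ord g; have := ltn_ord d; nia.
Qed.

Lemma group_member g d : group (member g d) = g.
Proof.
by apply: val_inj; rewrite /= memberE modnMDl modn_small.
Qed.

Lemma member_inj g : injective (member g).
Proof.
move=> d e /(congr1 val) /=; rewrite -!/(nat_of_ord _) !memberE.
by move/addIn/eqP; rewrite eqn_pmul2r // => /eqP/val_inj.
Qed.

(** The sample space: per group, a random member and a fair coin. Expectations become sums over
    states, compared with [#|state|]. *)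
Definition state := {ffun 'I_K -> 'I_K * bool}.
Implicit Types (st : state) (g h d : 'I_K) (i : 'I_n.+1).

(* Group g has a deviating agent iff (st g).2, and it is then its member number
   (st g).1. *)
Definition marked st g : 'I_n.+1 := member g (st g).1.

Definition deviates st i := (st (group i)).2 && (marked st (group i) == i).

Definition level (b : bool) : R := (if b then 2^-1 else (K%:R)^-1)%R.

Definition prof st : profile n.+1 :=
  fun i => type_of (group i) (level (deviates st i)).

Lemma good_levels b : good_level (level b).
Proof.
have K0 : 0 < K%:R :> R by rewrite ltr0n.
rewrite /good_level /level /iv; case: b.
  rewrite ltf_pV2 ?posrE ?ltr0n // ltr_nat; apply/andP; split; last by lra.
  by rewrite ltnS (leq_ltn_trans _ K_lt).
rewrite ltf_pV2 ?posrE ?ltr0n // ltr_nat (ltn_trans K_lt) //=.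
by rewrite invf_lt1 // ltr1n.
Qed.

Lemma prof_admissible st : admissible_profile N (prof st).
Proof. by move=> i; apply/type_admissible/good_levels. Qed.

(** Pairs the states where the marked member of [g] deviates with those where it does not. *)
Definition flip g st : state :=
  [ffun h => if h == g then ((st g).1, ~~ (st g).2) else st h].

Lemma flipK g : involutive (flip g).
Proof.
move=> st; apply/ffunP => h; rewrite !ffunE eqxx /= negbK.
by case: eqP => [->|//]; case: (st g).
Qed.

Lemma marked_flip g st : marked (flip g st) g = marked st g.
Proof. by rewrite /marked ffunE eqxx. Qed.

(** A flip changes the report of a single agent, which is what truthfulness and ordinality can
    compare. *)
Lemma prof_flip g st : (st g).2 = false ->
  prof (flip g st) = update (prof st) (marked st g) (type_of g (level true)).
Proof.
move=> bg; apply: functional_extensionality => k; rewrite /prof /update.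
have gm : group (marked st g) = g by rewrite group_member.
case: (eqVneq k (marked st g)) => [->|km].
  by rewrite /deviates gm marked_flip eqxx ffunE eqxx bg.
congr (type_of _ (level _)); rewrite /deviates.
case: (eqVneq (group k) g) => [->|kg].
  by rewrite marked_flip ffunE eqxx bg [_ == k]eq_sym (negPf km).
by rewrite /marked ffunE (negPf kg).
Qed.

(** * A mechanism on the random profiles *)

Section Mechanism.
Variable J : mechanism n.+1.
Hypothesis mechJ : is_mechanism N J.

Let p st := alloc_prob J (prof st).
Let distJ st := mechJ (prof_admissible st).

(** Common consequence of truthfulness and ordinality. The factor [K] is the top value over the
    level [1 / K]; the last term pays for fillers. *)
Definition responsive := forall st g, (st g).2 = false ->
  p (flip g st) (marked st g) (group_item g) <=
  K%:R * p st (marked st g) ord_max + p st (marked st g) (group_item g)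
    + K%:R * iv.

Lemma exp_utilityE u v i : exp_utility J u v i = \sum_s J u s * v (s i).
Proof. by []. Qed.

Lemma prof_unmarked st g : (st g).2 = false ->
  prof st (marked st g) = type_of g (level false).
Proof. by move=> bg; rewrite /prof /deviates group_member bg. Qed.

Lemma exp_weight_le st i g x : 0 <= x ->
  \sum_s J (prof st) s * weight g x (s i) <=
  p st i ord_max + x * p st i (group_item g) + iv.
Proof.
move=> x0; have [J0 J1] := (dist_ge0 (distJ st), dist_sum1 (distJ st)).
rewrite -[X in _ + X]mul1r -J1 mulr_suml /p /alloc_prob mulr_sumr -!big_split /=.
apply: ler_sum => s _; rewrite mulrCA -!mulrDr.
by apply: ler_wpM2l => //; apply: weight_le.
Qed.

(** An agent of true level [1 / K] must not gain by reporting [1 / 2]. Both sides use its true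
    valuation, so the scaling cancels; then multiply by [K]. *)
Lemma truthful_responsive : truthful N J -> responsive.
Proof.
move=> trJ st g bg; pose i := marked st g.
have K0 : 0 < K%:R :> R by rewrite ltr0n.
have x0 : 0 <= level false by rewrite invr_ge0 ltW.
have /RleP := trJ i _ _ (prof_admissible st) (type_admissible g (good_levels true)).
rewrite !exp_utilityE -prof_flip // prof_unmarked // /type_of /normalize.
set c := scaling _ _.
have c0 : 0 < c by have /andP[h _] := scaling_weight g (good_levels false); rewrite -/c in h; lra.
under eq_bigr do rewrite mulrCA; rewrite -mulr_sumr.
under [leRHS]eq_bigr do rewrite mulrCA; rewrite -mulr_sumr ler_pM2l // => tr.
have lo : level false * p (flip g st) i (group_item g) <=
    \sum_s J (prof (flip g st)) s * weight g (level false) (s i).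
  rewrite /p /alloc_prob mulr_sumr; apply: ler_sum => s _; rewrite mulrCA.
  by apply: ler_wpM2l; [exact: dist_ge0 (distJ _) _ | exact: weight_ge].
have := le_trans lo (le_trans tr (exp_weight_le st i g x0)).
rewrite /level ler_pdivrMl // !mulrDr mulrA mulfV ?lt0r_neq0 // mul1r.
by [].
Qed.

(** Both levels induce the same ordering, so the flip leaves the distribution unchanged. *)
Lemma ordinal_responsive : ordinal_mech N J -> responsive.
Proof.
move=> ordJ st g bg; pose i := marked st g.
have same : same_order (prof st i) (type_of g (level true)).
  rewrite prof_unmarked //.
  have sc b : 0 < scaling N (weight g (level b)).
    by have /andP[h _] := scaling_weight g (good_levels b); lra.
  move=> j k; rewrite /type_of /normalize.
  split=> /RltP h; apply/RltP; move: h; rewrite !ltr_pM2l //;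
    exact: weight_same_order (good_levels _) (good_levels _) _ _.
have eqJ := ordJ i _ _ (prof_admissible st) (type_admissible g (good_levels true)) same.
have -> : p (flip g st) (marked st g) (group_item g) = p st (marked st g) (group_item g).
  by apply: eq_bigr => s _; rewrite prof_flip // -eqJ.
rewrite -addrA addrCA lerDl addr_ge0 // mulr_ge0 ?ler0n ?(ltW iv_gt0) //.
exact: alloc_prob_ge0 (distJ st) _ _.
Qed.

(** The 3 is one unit each for the common item, the [K] group items at level [1 / K], and the
    fillers. Deviating agents are charged an extra 1 per group item. *)
Lemma exp_welfare_prof_le st :
  exp_welfare J (prof st) <=
  3 + \sum_g (st g).2%:R * p st (marked st g) (group_item g).
Proof.
have J0 := dist_ge0 (distJ st); have p0 := alloc_prob_ge0 (distJ st).
have psum := alloc_prob_sum (distJ st).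
have -> : exp_welfare J (prof st) = \sum_s J (prof st) s * \sum_i prof st i (s i) by [].
under eq_bigr do rewrite mulr_sumr; rewrite exchange_big /=.
pose q i := p st i (group_item (group i)).
apply: (@le_trans _ _ (\sum_i (p st i ord_max + ((K%:R)^-1 * q i +
    (deviates st i)%:R * q i) + iv))).
  apply: ler_sum => i _.
  apply: (@le_trans _ _ (\sum_s J (prof st) s *
     weight (group i) (level (deviates st i)) (s i))).
    apply: ler_sum => s _; apply: ler_wpM2l => //.
    have /andP[_ sc1] := scaling_weight (group i) (good_levels (deviates st i)).
    have /andP[w0 _] := weight_bounds (group i) (s i) (good_levels (deviates st i)).
    by rewrite /prof /type_of /normalize ler_piMl.
  have l0 : 0 <= level (deviates st i).
    by have /andP[h _] := good_levels (deviates st i); have := iv_gt0; lra.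
  apply: le_trans (exp_weight_le st i (group i) l0) _.
  rewrite lerD2r lerD2l -mulrDl; apply: ler_wpM2r; first exact: p0.
  rewrite /level; have : 0 <= (K%:R)^-1 :> R by rewrite invr_ge0.
  by case: deviates => /=; lra.
rewrite !big_split /= psum sumr_const card_ord -[iv *+ _]mulr_natl divff ?pnatr_eq0 //.
have h1 : \sum_i (K%:R)^-1 * q i <= 1.
  rewrite -mulr_sumr ler_pdivrMl ?ltr0n // mulr1 (partition_big group xpredT) //=.
  apply: (@le_trans _ _ (\sum_(g : 'I_K) 1)); last by rewrite sumr_const card_ord.
  apply: ler_sum => g _; rewrite -(psum (group_item g)) big_mkcond.
  apply: ler_sum => i _; case: eqP => [<-|_]; [exact: lexx | exact: p0].
have h2 : \sum_i (deviates st i)%:R * q i <=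
    \sum_g (st g).2%:R * p st (marked st g) (group_item g).
  rewrite (partition_big group xpredT) //=; apply: ler_sum => g _.
  rewrite (bigD1 (marked st g)) ?group_member //= big1 => [|i /andP[/eqP gi im]].
    by rewrite addr0 /q /deviates !group_member eqxx andbT.
  by rewrite /deviates gi [_ == i]eq_sym (negPf im) andbF mul0r.
by lra.
Qed.

(* (st, d) |-> (st with member d marked in group g, member formerly marked):
   an involution, which averages over the marked member. *)
Definition swap g (x : state * 'I_K) : state * 'I_K :=
  ([ffun h => if h == g then (x.2, (x.1 g).2) else x.1 h], (x.1 g).1).

Lemma swapK g : involutive (swap g).
Proof.
case=> st d; rewrite /swap /= !ffunE eqxx /=; congr (_, _).
by apply/ffunP => h; rewrite !ffunE; case: eqP => [->|//]; case: (st g).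
Qed.

(** When nobody in [g] deviates, the mechanism cannot see which member is marked. *)
Lemma prof_swap g (x : state * 'I_K) : (x.1 g).2 = false -> prof (swap g x).1 = prof x.1.
Proof.
case: x => st d /= bg; apply: functional_extensionality => k.
congr (type_of _ (level _)); rewrite /deviates /marked /= !ffunE.
by case: (eqVneq (group k) g) => [->|//]; rewrite bg.
Qed.

Hypothesis respJ : responsive.

(** Flipping reduces to states where [g] has no deviating agent; there the marked member is hidden,
    and averaging over all [K] members gains a factor [1 / K]. *)
Lemma sum_marked_prob_le :
  \sum_(st : state) \sum_g (st g).2%:R * p st (marked st g) (group_item g) <= 3 * #|state|%:R.
Proof.
have K0 : 0 < K%:R :> R by rewrite ltr0n.
pose H (g : 'I_K) st d :=
  K%:R * p st (member g d) ord_max + p st (member g d) (group_item g) + K%:R * iv.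
have H0 g st d : 0 <= H g st d.
  by rewrite !addr_ge0 ?mulr_ge0 ?ler0n ?(ltW iv_gt0) //;
    apply: alloc_prob_ge0 (distJ st) _ _.
have step g : \sum_(st : state) (st g).2%:R * p st (marked st g) (group_item g) <=
    (K%:R)^-1 * \sum_(st : state) \sum_d H g st d.
  rewrite ler_pdivlMl //.
  apply: (@le_trans _ _ (K%:R * \sum_(st : state) (~~ (st g).2)%:R * H g st (st g).1)).
    rewrite ler_pM2l // (reindex_inj (inv_inj (flipK g))); apply: ler_sum => st _.
    rewrite marked_flip ffunE eqxx /=; case bg: (st g).2; first by rewrite !mul0r.
    by rewrite !mul1r; apply: respJ.
  have -> : K%:R * \sum_(st : state) (~~ (st g).2)%:R * H g st (st g).1 =
      \sum_(x : state * 'I_K) (~~ (x.1 g).2)%:R * H g x.1 (x.1 g).1.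
    rewrite -(pair_bigA _ (fun (st : state) (d : 'I_K) =>
      (~~ (st g).2)%:R * H g st (st g).1)) /= mulr_sumr.
    by apply: eq_bigr => st _; rewrite sumr_const card_ord mulr_natl.
  rewrite (reindex_inj (inv_inj (swapK g))) pair_bigA /=; apply: ler_sum => x _.
  rewrite ffunE eqxx /=; case bg: (x.1 g).2; first by rewrite mul0r H0.
  by rewrite mul1r /H /p; have /= := prof_swap bg; rewrite bg => ->.
(* Each term of [H] adds up to at most [K]: the common item is assigned once, there are [K] group
   items, and [K * K <= n.+1]. *)
have total st : \sum_g \sum_d H g st d <= 3 * K%:R.
  have p0 := alloc_prob_ge0 (distJ st); have psum := alloc_prob_sum (distJ st).
  under eq_bigr do rewrite !big_split /= -mulr_sumr.
  rewrite !big_split /= -mulr_sumr.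
  have h1 : \sum_g \sum_d p st (member g d) ord_max <= 1.
    rewrite pair_bigA -(psum ord_max) /=.
    apply: (sum_inj_le (h := fun x => member x.1 x.2)) => // -[g d] [g' d'] /= e.
    have eg : g = g' by rewrite -(group_member g d) e group_member.
    by congr (_, _) => //; apply: (@member_inj g); rewrite {2}eg.
  have h2 : \sum_g \sum_d p st (member g d) (group_item g) <= K%:R.
    apply: (@le_trans _ _ (\sum_(g : 'I_K) 1)); last by rewrite sumr_const card_ord.
    apply: ler_sum => g _; rewrite -(psum (group_item g)).
    by apply: (sum_inj_le (h := member g)) => //; apply: member_inj.
  have h3 : \sum_(g : 'I_K) \sum_(d : 'I_K) K%:R * iv <= K%:R.
    rewrite !sumr_const !card_ord -mulrnA -[leLHS]mulr_natl mulrCA ger_pMr //.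
    by rewrite /iv ler_pdivrMr ?ltr0n // mul1r ler_nat.
  have h1' : K%:R * \sum_g \sum_d p st (member g d) ord_max <= K%:R.
    by rewrite ger_pMr.
  by lra.
rewrite exchange_big; apply: le_trans (ler_sum _ (fun g _ => step g)) _.
rewrite -mulr_sumr ler_pdivrMl // exchange_big.
apply: le_trans (ler_sum _ (fun st _ => total st)) _.
by rewrite sumr_const -mulr_natr; lra.
Qed.

(** Hand each marked agent its group's item: a deviating one has weight [1 / 2] for it, scaled by at
    least [1 / 3]. *)
Lemma wstar_prof_ge st : 6^-1 * \sum_g (st g).2%:R <= wstar (prof st).
Proof.
have mi : injective (marked st).
  by move=> g h e; rewrite -(group_member g (st g).1) -/(marked st g) e group_member.
have [s sP] := perm_extending mi group_item_inj.
apply: le_trans (wstar_ge _ s).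
have -> : welfare (prof st) s = \sum_i prof st i (s i) by [].
apply: le_trans (sum_inj_le mi _); last first.
  by move=> i; apply: admissible_ge0 (prof_admissible st i) _.
rewrite mulr_sumr; apply: ler_sum => g _; rewrite sP.
case bg: (st g).2; last by rewrite mulr0; apply: admissible_ge0 (prof_admissible st _) _.
rewrite /prof /deviates !group_member bg eqxx /type_of /normalize /weight.
rewrite (negPf (group_item_neq_max g)) eqxx mulr1.
have /andP[+ _] := scaling_weight g (good_levels true).
by rewrite /weight /=; lra.
Qed.

(** On average over states the optimum is at least [K / 12] and the welfare at most [3 + 3], whence
    [72 = 12 * 6]. *)
Lemma ar_hard_instance : ar N J <= 72 / K%:R.
Proof.
have K0 : 0 < K%:R :> R by rewrite ltr0n.
rewrite ler_pdivlMr //; case: (leP (ar N J) 0) => [ar0|ar0]; first by nra.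
have S0 : 0 < #|state|%:R :> R.
  by rewrite ltr0n; apply/card_gt0P; exists [ffun=> (Ordinal K_gt0, true)].
have half g : \sum_(st : state) (st g).2%:R = 2^-1 * #|state|%:R :> R.
  suff : \sum_(st : state) (st g).2%:R + \sum_(st : state) (st g).2%:R
      = #|state|%:R :> R by lra.
  rewrite {2}(reindex_inj (inv_inj (flipK g))) -big_split /= -sumr_const.
  by apply: eq_bigr => st _; rewrite ffunE eqxx; case: (st g).2; rewrite /= ?addr0 ?add0r.
have low : 12^-1 * K%:R * #|state|%:R <= \sum_(st : state) wstar (prof st).
  apply: le_trans (ler_sum _ (fun st _ => wstar_prof_ge st)).
  rewrite -mulr_sumr exchange_big /= (eq_bigr _ (fun g _ => half g)).
  by rewrite sumr_const card_ord -mulr_natr; lra.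
have up : \sum_(st : state) exp_welfare J (prof st) <= 6 * #|state|%:R.
  apply: le_trans (ler_sum _ (fun st _ => exp_welfare_prof_le st)) _.
  rewrite big_split /= sumr_const -mulr_natr.
  by have := sum_marked_prob_le; lra.
have mid : ar N J * \sum_(st : state) wstar (prof st) <= \sum_(st : state) exp_welfare J (prof st).
  by rewrite mulr_sumr; apply: ler_sum => st _; apply: ar_wstar_le (prof_admissible st).
have : ar N J * (12^-1 * K%:R * #|state|%:R) <= 6 * #|state|%:R.
  by apply: le_trans (le_trans mid up); rewrite ler_pM2l.
rewrite mulrA ler_pM2r //; lra.
Qed.

End Mechanism.
End HardInstance.

Lemma ar_le_truthful_or_ordinal (N : normalization) (n : nat) (J : mechanism n.+1) :
  (min_agents N <= n.+1)%N -> is_mechanism N J ->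
  truthful N J \/ ordinal_mech N J -> ar N J <= 144 / Num.sqrt n.+1%:R.
Proof.
move=> minN mJ hJ.
have q0 : 0 < Num.sqrt n.+1%:R :> R by rewrite sqrtr_gt0 ltr0n.
have q2 : Num.sqrt n.+1%:R ^+ 2 = n.+1%:R :> R by rewrite sqr_sqrtr ?ler0n.
(* The integer square root; [n.+1 < K.+1 * K.+1] gives the bound [2 * K] on the root, which doubles
   72 to 144. *)
have [K KK nK] : exists2 K, (K * K <= n.+1)%N & (n.+1 < K.+1 * K.+1)%N.
  elim: n.+1 => [|m [K h1 h2]]; first by exists 0%N.
  by case: (ltnP m.+1 (K.+1 * K.+1)) => h; [exists K | exists K.+1]; nia.
(* With at most three agents the trivial bound 1 suffices. *)
case: (ltnP 1 K) => K1; last first.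
  apply: (@le_trans _ _ 1); first exact/ar_le1/admissible_exists.
  rewrite ler_pdivlMr // mul1r -ler_sqr ?nnegrE ?(ltW q0) // q2 -natrX ler_nat.
  by nia.
have K0 : 0 < K%:R :> R by rewrite ltr0n ltnW.
have resp : responsive N K1 J.
  by case: hJ => [/(truthful_responsive K1 KK mJ)|/(ordinal_responsive K1 KK mJ)].
apply: le_trans (ar_hard_instance KK mJ resp) _.
rewrite ler_pdivrMr // mulrAC ler_pdivlMr //.
suff : Num.sqrt n.+1%:R <= 2 * K%:R :> R by lra.
rewrite -ler_sqr ?nnegrE ?(ltW q0) ?mulr_ge0 ?(ltW K0) // q2 exprMn -!natrX -natrM.
by rewrite ler_nat; nia.
Qed.

Local Open Scope R_scope.

Theorem theorem1 :
  (* (i) ar(RP) = Theta(n^{-1/2}) *)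
  (forall N : normalization, exists c C : R, 0 < c /\ 0 < C /\
     forall n : nat, (min_agents N <= n)%nat ->
       c / sqrt (INR n) <= ar N (@RP n) /\ ar N (@RP n) <= C / sqrt (INR n)) /\
  (* (ii) truthful-in-expectation mechanisms *)
  (forall N : normalization, exists C' : R, 0 < C' /\
     forall (n : nat) (J : mechanism n), (min_agents N <= n)%nat ->
       is_mechanism N J -> truthful N J -> ar N J <= C' / sqrt (INR n)) /\
  (* (iii) ordinal mechanisms *)
  (forall N : normalization, exists C'' : R, 0 < C'' /\
     forall (n : nat) (J : mechanism n), (min_agents N <= n)%nat ->
       is_mechanism N J -> ordinal_mech N J -> ar N J <= C'' / sqrt (INR n)).
Proof.
have bound N n (J : mechanism n) : (min_agents N <= n)%N -> is_mechanism N J ->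
    (truthful N J \/ ordinal_mech N J)%type -> ar N J <= 144%:R%R / sqrt (INR n).
  case: n J => [|n] J minN mJ hJ; first by case: N minN {mJ hJ}.
  apply/RleP; rewrite RdivE RsqrtE INRE; exact: ar_le_truthful_or_ordinal.
have C0 : 0 < 144%:R%R by apply/RltP; rewrite ltr0n.
split; last split.
- move=> N; exists (2^-1)%R, (144%:R)%R; split; first by apply/RltP; rewrite invr_gt0 ltr0n.
  split=> // n minN; split; last first.
    (* Serial dictatorship only compares values, so random priority is ordinal. *)
    by apply: bound => //; [exact: RP_mechanism | right; exact: RP_ordinal].
  case: n minN => [|n] minN; first by case: N minN.
  by apply/RleP; rewrite RdivE RsqrtE INRE; exact: ar_RP_ge.
- move=> N; exists (144%:R)%R; split=> // n J minN mJ hJ.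
  by apply: bound => //; left.
- move=> N; exists (144%:R)%R; split=> // n J minN mJ hJ.
  by apply: bound => //; right.
Qed.
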